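(* Let $\mathcal X \in \mathbb R^{D_1 \times \cdots \times D_N}$ and let $d_n \le D_n$ for $n \in [N]$. Let $\{\mathbf U_n^{(q)}\}_{n\in[N],\, q\ge 0}$ be the bases generated by the L1-HOOI iterations (described in the context) applied to $\mathcal X$, from an arbitrary feasible initialization $\{\mathbf U_n^{(0)} \in \mathbb S(D_n,d_n)\}_{n\in[N]}$. Then the iterations converge in the L1-Tucker metric: the sequence of real numbers $$\left\| \mathcal X \times_{n\in[N]} {\mathbf U_n^{(q)}}^\top \right\|_1,\qquad q=1,2,\dots,$$ converges as $q\to\infty$.
   Context: Notation: $[N]=\{1,\dots,N\}$; $\mathbb S(D,d)=\{\mathbf U\in\mathbb R^{D\times d}: \mathbf U^\top\mathbf U=\mathbf I_d\}$; $\|\cdot\|_1$ is the entrywise L1-norm (sum of absolute values of all entries) of a matrix or tensor. For a tensor $\mathcal X\in\mathbb R^{D_1\times\cdots\times D_N}$, $[\mathcal X]_{(n)}\in\mathbb R^{D_n\times\prod_{m\ne n}D_m}$ is the mode-$n$ unfolding (its columns are the mode-$n$ fibers, in the standard order), and $\times_n$ is the mode-$n$ tensor-by-matrix product, so that $[\mathcal X\times_n\mathbf M]_{(n)}=\mathbf M[\mathcal X]_{(n)}$; $\times_{n\in[N]}$, $\times_{m<n}$, $\times_{k>n}$ denote successive products over all the indicated modes. The L1-Tucker metric of bases $\{\mathbf U_n\in\mathbb S(D_n,d_n)\}_{n\in[N]}$ is $\|\mathcal X\times_{n\in[N]}\mathbf U_n^\top\|_1$. L1PCA-AO: for $\mathbf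 A\in\mathbb R^{D\times d}$ with $d\le D$ and (thin) SVD $\mathbf A=\mathbf W\mathbf S\mathbf Q^\top$ ($\mathbf W\in\mathbb S(D,d)$, $\mathbf S\in\mathbb R^{d\times d}$ nonnegative diagonal, $\mathbf Q\in\mathbb R^{d\times d}$ orthogonal), put $\Phi(\mathbf A)=\mathbf W\mathbf Q^\top$ (any SVD may be chosen). $\mathrm{sgn}(\cdot)$ acts entrywise with values in $\{\pm1\}$ and $\mathrm{sgn}(0)=1$. Given a matrix $\mathbf X\in \mathbb R^{D\times D'}$ and $\mathbf U_0\in\mathbb S(D,d)$, $\texttt{L1PCA-AO}(\mathbf X,\mathbf U_0)$ is the matrix obtained after some finite number $T\ge1$ (decided by any termination rule) of the iterations $\mathbf U_t=\Phi(\mathbf X\,\mathrm{sgn}(\mathbf X^\top\mathbf U_{t-1}))$, $t=1,\dots,T$. L1-HOOI: starting from arbitrary $\mathbf U_n^{(0)}\in\mathbb S(D_n,d_n)$, $n\in[N]$, for $q=1,2,\dots$ and, within each $q$, successively for $n=1,2,\dots,N$, set $\mathbf U_n^{(q)}=\texttt{L1PCA-AO}(\mathbf A_n^{(q)},\mathbf U_n^{(q-1)})$, where $$\mathbf A_n^{(q)}=\Big[\mathcal X\times_{m<n}{\mathbf U_m^{(q)}}^\top\times_{k>n}{\mathbf U_k^{(q-1)}}^\top\Big]_{(n)}.$$ *)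

(* Defs.v *)
From HB Require Import structures.
From mathcomp Require Import all_boot all_order all_algebra.
From mathcomp Require Import all_classical all_reals all_analysis.

Set Implicit Arguments.
Unset Strict Implicit.
Unset Printing Implicit Defensive.

Import Order.TTheory GRing.Theory Num.Theory.
Import numFieldNormedType.Exports.

Local Open Scope ring_scope.

(* Modes and indices are numbered from 0. *)

Definition tensor (R : Type) (N : nat) (D : 'I_N -> nat) : Type :=
  {dffun forall n : 'I_N, 'I_(D n)} -> R.

(* Successive mode products change the dimensions one mode at a time.  To avoid
   casts between the corresponding dependent types, they are computed on arrays
   whose multi-indices are plain natural numbers; a tensor of dimensions D is
   the array that extends it by zero outside the box D. *)
Definition array (R : Type) (N : nat) : Type := {ffun 'I_N -> nat} -> R.

Definition array_of (R : nzRingType) (N : nat) (D : 'I_N -> nat)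
    (X : tensor R D) : array R N :=
  fun i => if [pick j : {dffun forall n : 'I_N, 'I_(D n)}
                 | [forall n, (j n : nat) == i n]] is Some j
           then X j else 0.

Definition tensor_of (R : Type) (N : nat) (E : 'I_N -> nat)
    (Y : array R N) : tensor R E :=
  fun j => Y [ffun n => (j n : nat)].

Definition set_index (N : nat) (i : {ffun 'I_N -> nat}) (n : 'I_N) (c : nat) :
    {ffun 'I_N -> nat} :=
  [ffun m => if m == n then c else i m].

(* (Y x_n M)(.., r, ..) = \sum_c M r c * Y(.., c, ..), position n being shown;
   zero when r is not a row index of M. *)
Definition mode_prod (R : nzRingType) (N : nat) (n : 'I_N) (p q : nat)
    (M : 'M[R]_(p, q)) (Y : array R N) : array R N :=
  fun i => if @insub nat (fun r => (r < p)%N) 'I_p (i n) is Some r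
           then \sum_(c < q) M r c * Y (set_index i n c) else 0.

Definition mode_prods (R : nzRingType) (N : nat) (p q : 'I_N -> nat)
    (s : seq 'I_N) (M : forall n : 'I_N, 'M[R]_(p n, q n)) (Y : array R N) :
    array R N :=
  foldl (fun Z n => mode_prod n (M n) Z) Y s.

(* Position in mode k of the c-th mode-n fiber, modes k != n having dimension
   E k and earlier modes varying faster. *)
Definition fiber_index (N : nat) (E : 'I_N -> nat) (n : 'I_N) (c : nat)
    (k : 'I_N) : nat :=
  ((c %/ (\prod_(m < N | (m < k) && (m != n)) E m)) %% E k)%N.

(* Mode-n unfolding of an array of dimension p in mode n and E k in each mode
   k != n; the value E n is not used. *)
Definition unfolding (R : Type) (N : nat) (n : 'I_N) (p : nat)
    (E : 'I_N -> nat) (Y : array R N) :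
    'M[R]_(p, (\prod_(m < N | m != n) E m)%N) :=
  \matrix_(r, c) Y [ffun k => if k == n then (r : nat) else fiber_index E n c k].

Lemma unfolding_mode_prod (R : nzRingType) (N : nat) (n : 'I_N) (p q : nat)
    (E : 'I_N -> nat) (M : 'M[R]_(p, q)) (Y : array R N) :
  unfolding n p E (mode_prod n M Y) = M *m unfolding n q E Y.
Proof.
apply/matrixP => r c; rewrite !mxE /mode_prod ffunE eqxx insubT // => lt_r.
apply: eq_bigr => k _; rewrite !mxE; congr (M _ _ * Y _); first exact: val_inj.
by apply/ffunP => m; rewrite !ffunE; case: eqP.
Qed.

Definition tensor_norm1 (R : realType) (N : nat) (E : 'I_N -> nat)
    (X : tensor R E) : R :=
  \sum_(j : {dffun forall n : 'I_N, 'I_(E n)}) `|X j|.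

Definition stiefel (R : realType) (D d : nat) (U : 'M[R]_(D, d)) : Prop :=
  U^T *m U = 1%:M.

Definition thin_svd (R : realType) (D d : nat) (A W : 'M[R]_(D, d))
    (s : 'rV[R]_d) (Q : 'M[R]_d) : Prop :=
  [/\ stiefel W, forall i, 0 <= s 0 i, stiefel Q
    & A = W *m diag_mx s *m Q^T].

(* Phi is a relation, since it depends on the choice of an SVD. *)
Definition Phi (R : realType) (D d : nat) (A B : 'M[R]_(D, d)) : Prop :=
  exists W s Q, thin_svd A W s Q /\ B = W *m Q^T.

Definition sgn_mx (R : realType) (m n : nat) (A : 'M[R]_(m, n)) : 'M[R]_(m, n) :=
  map_mx (fun x : R => if 0 <= x then 1 else -1) A.

(* V is a possible output of L1PCA-AO on (X, U0): neither the number of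
   iterations nor the SVDs are prescribed. *)
Definition L1PCA_AO (R : realType) (D D' d : nat) (X : 'M[R]_(D, D'))
    (U0 V : 'M[R]_(D, d)) : Prop :=
  exists (T : nat) (U : nat -> 'M[R]_(D, d)),
    [/\ (1 <= T)%N, U 0%N = U0,
        forall t : nat, (t < T)%N ->
          Phi (X *m sgn_mx (X^T *m U t)) (U t.+1)
      & V = U T].

(* The matrix A_n built from the bases U already updated in the current sweep
   (modes m < n) and the bases V of the previous sweep (modes k > n). *)
Definition HOOI_matrix (R : realType) (N : nat) (D d : 'I_N -> nat)
    (X : tensor R D) (U V : forall n : 'I_N, 'M[R]_(D n, d n)) (n : 'I_N) :
    'M[R]_(D n, (\prod_(m < N | m != n) d m)%N) :=
  unfolding n (D n) d
    (mode_prods [seq k : 'I_N <- enum 'I_N | (n < k)%N] (fun k => (V k)^T)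
      (mode_prods [seq m : 'I_N <- enum 'I_N | (m < n)%N] (fun m => (U m)^T)
        (array_of X))).

Definition L1_HOOI (R : realType) (N : nat) (D d : 'I_N -> nat)
    (X : tensor R D) (U : nat -> forall n : 'I_N, 'M[R]_(D n, d n)) : Prop :=
  (forall n : 'I_N, stiefel (U 0%N n)) /\
  (forall (q : nat) (n : 'I_N),
     L1PCA_AO (HOOI_matrix X (U q.+1) (U q) n) (U q n) (U q.+1 n)).

Definition L1_Tucker_metric (R : realType) (N : nat) (D d : 'I_N -> nat)
    (X : tensor R D) (U : forall n : 'I_N, 'M[R]_(D n, d n)) : R :=
  tensor_norm1 (tensor_of (E := d)
    (mode_prods (enum 'I_N) (fun n => (U n)^T) (array_of X))).

(* Main.v *)
Require Import Defs.
From HB Require Import structures.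
From mathcomp Require Import all_boot all_order all_algebra.
From mathcomp Require Import all_classical all_reals all_analysis.

Set Implicit Arguments.
Unset Strict Implicit.
Unset Printing Implicit Defensive.

Import Order.TTheory GRing.Theory Num.Theory.
Import numFieldNormedType.Exports.

Local Open Scope ring_scope.
Local Open Scope classical_set_scope.

(** Each inner iteration maximizes <U, A> over the Stiefel manifold for
    A = X sgn(X^T U_{t-1}) (Procrustes), and <U, A> equals |X^T U|_1 at U_{t-1}
    while it is at most |X^T U|_1 elsewhere; hence |X^T U|_1 never decreases.
    Since the unfolding only permutes entries, updating mode n in a sweep
    modifies the L1-Tucker metric in the same way, so the metric is
    nondecreasing in q.  It is bounded because the entries of Stiefel matrices
    lie in [-1, 1]. *)

(** * The entrywise L1-norm as a trace pairing with sign matrices *)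

Definition mx_norm1 (R : realType) (m n : nat) (A : 'M[R]_(m, n)) : R :=
  \sum_i \sum_j `|A i j|.

Lemma mx_norm1_tr (R : realType) (m n : nat) (A : 'M[R]_(m, n)) :
  mx_norm1 A^T = mx_norm1 A.
Proof.
rewrite /mx_norm1 exchange_big /=.
by apply: eq_bigr => i _; apply: eq_bigr => j _; rewrite mxE.
Qed.

Lemma mxtrace_tr_mul (R : realType) (m n : nat) (A B : 'M[R]_(m, n)) :
  \tr (A^T *m B) = \sum_i \sum_j A i j * B i j.
Proof.
rewrite exchange_big /=; apply: eq_bigr => j _; rewrite mxE.
by apply: eq_bigr => i _; rewrite mxE.
Qed.

(** Entrywise, [x * sgn x] is the absolute value of [x]; at [x = 0] the convention for the sign is
    harmless. *)
Lemma mxtrace_sgn_mx (R : realType) (m n : nat) (A : 'M[R]_(m, n)) :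
  \tr (A^T *m sgn_mx A) = mx_norm1 A.
Proof.
rewrite mxtrace_tr_mul; apply: eq_bigr => i _; apply: eq_bigr => j _.
rewrite mxE; case: ifPn => [Age0|]; first by rewrite mulr1 ger0_norm.
by rewrite -ltNge => /ltW Ale0; rewrite mulrN1 ler0_norm.
Qed.

Lemma mxtrace_sgn_mx_le (R : realType) (m n : nat) (A B : 'M[R]_(m, n)) :
  \tr (A^T *m sgn_mx B) <= mx_norm1 A.
Proof.
rewrite mxtrace_tr_mul; apply: ler_sum => i _; apply: ler_sum => j _.
rewrite mxE; apply: le_trans (ler_norm _) _; rewrite normrM.
by case: ifP; rewrite ?normrN normr1 mulr1.
Qed.

(** * Stiefel matrices *)

Lemma stiefel_col (R : realType) (D d : nat) (U : 'M[R]_(D, d)) (i : 'I_d) :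
  stiefel U -> \sum_k U k i ^+ 2 = 1.
Proof.
move=> /matrixP/(_ i i); rewrite !mxE eqxx => U1; apply: etrans U1.
by apply: eq_bigr => k _; rewrite mxE expr2.
Qed.

Lemma stiefel_entry_le1 (R : realType) (D d : nat) (U : 'M[R]_(D, d)) i j :
  stiefel U -> `|U i j| <= 1.
Proof.
move=> /(stiefel_col j) U1.
rewrite -(@expr_le1 _ 2) // real_normK ?num_real //.
by rewrite -U1 (bigD1 i) //= lerDl sumr_ge0 // => k _; rewrite sqr_ge0.
Qed.

(** The entry is an inner product of two unit columns; summing [2ab <= a^2 + b^2] over their
    coordinates takes the place of Cauchy-Schwarz. *)
Lemma stiefel_tr_mul_diag_le1 (R : realType) (D d : nat) (U W : 'M[R]_(D, d))
    (i : 'I_d) :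
  stiefel U -> stiefel W -> (U^T *m W) i i <= 1.
Proof.
move=> /(stiefel_col i) U1 /(stiefel_col i) W1.
rewrite -(ler_pM2l (ltr0Sn R 1)) mulr1.
have UW2 : \sum_k (U k i ^+ 2 + W k i ^+ 2) = 2 by rewrite big_split /= U1 W1.
rewrite -[leRHS]UW2 mxE mulr_sumr.
apply: ler_sum => k _; rewrite mxE -subr_ge0.
have -> : U k i ^+ 2 + W k i ^+ 2 - 2 * (U k i * W k i)
   = (U k i - W k i) ^+ 2 by rewrite sqrrB mulr_natl addrAC.
exact: sqr_ge0.
Qed.

Lemma stiefel_mul (R : realType) (D d : nat) (U : 'M[R]_(D, d)) (Q : 'M[R]_d) :
  stiefel U -> stiefel Q -> stiefel (U *m Q).
Proof.
by rewrite /stiefel => U1 Q1; rewrite trmx_mul mulmxA -(mulmxA Q^T) U1 mulmx1.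
Qed.

(** For square matrices a left inverse is also a right inverse. *)
Lemma stiefel_tr (R : realType) (d : nat) (Q : 'M[R]_d) :
  stiefel Q -> stiefel Q^T.
Proof. by rewrite /stiefel trmxK; exact: mulmx1C. Qed.

(** * Procrustes optimality and monotonicity of L1PCA-AO *)

Lemma Phi_stiefel (R : realType) (D d : nat) (A B : 'M[R]_(D, d)) :
  Phi A B -> stiefel B.
Proof.
by move=> [W [s [Q [[W1 _ Q1 _] ->]]]]; apply/stiefel_mul/stiefel_tr.
Qed.

(** By cyclicity, the trace for [V] is a combination of the singular values whose weights are the
    diagonal entries of [(V *m Q)^T *m W]. These are at most 1 for a Stiefel [V], and all equal 1
    when [V = W *m Q^T]. *)
Lemma Phi_procrustes (R : realType) (D d : nat) (A B U : 'M[R]_(D, d)) :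
  Phi A B -> stiefel U -> \tr (U^T *m A) <= \tr (B^T *m A).
Proof.
move=> [W [s [Q [[W1 s0 Q1 ->] ->]]]] U1.
have trE V : \tr (V^T *m (W *m diag_mx s *m Q^T))
    = \sum_i ((V *m Q)^T *m W) i i * s 0 i.
  rewrite mulmxA mxtrace_mulC !mulmxA -trmx_mul mul_mx_diag.
  by apply: eq_bigr => i _; rewrite [LHS]mxE.
rewrite !trE; apply: ler_sum => i _; apply: ler_wpM2r => //.
have -> : W *m Q^T *m Q = W by rewrite -mulmxA Q1 mulmx1.
by rewrite W1 [leRHS]mxE eqxx; apply/stiefel_tr_mul_diag_le1/W1/stiefel_mul.
Qed.

Lemma L1PCA_step_mono (R : realType) (D D' d : nat) (X : 'M[R]_(D, D'))
    (U V : 'M[R]_(D, d)) :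
  stiefel U -> Phi (X *m sgn_mx (X^T *m U)) V ->
  mx_norm1 (X^T *m U) <= mx_norm1 (X^T *m V).
Proof.
move=> U1 PhiV; rewrite -mxtrace_sgn_mx.
apply: le_trans (mxtrace_sgn_mx_le _ (X^T *m U)).
by rewrite !trmx_mul !trmxK -!mulmxA; exact: Phi_procrustes.
Qed.

Lemma L1PCA_AO_stiefel (R : realType) (D D' d : nat) (X : 'M[R]_(D, D'))
    (U V : 'M[R]_(D, d)) :
  L1PCA_AO X U V -> stiefel V.
Proof.
(* As at least one iteration is run, the output is a value of [Phi]. *)
move=> [T [W [T_gt0 _ PhiW ->]]]; case: T T_gt0 PhiW => // T _ PhiW.
exact: Phi_stiefel (PhiW _ (ltnSn T)).
Qed.

Lemma L1PCA_AO_mono (R : realType) (D D' d : nat) (X : 'M[R]_(D, D'))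
    (U V : 'M[R]_(D, d)) :
  stiefel U -> L1PCA_AO X U V ->
  mx_norm1 (X^T *m U) <= mx_norm1 (X^T *m V).
Proof.
move=> U1 [T [W [_ W0 PhiW ->{V}]]]; rewrite -{U}W0 in U1 *.
(* The Stiefel property is carried along because each single step requires it of its input. *)
suff: forall t, (t <= T)%N ->
    stiefel (W t) /\ mx_norm1 (X^T *m W 0%N) <= mx_norm1 (X^T *m W t).
  by move=> /(_ T (leqnn T)) [].
elim=> [//|t IHt] lt_tT; have [Wt1 le0t] := IHt (ltnW lt_tT).
have PhiWt := PhiW _ lt_tT; split; first exact: Phi_stiefel PhiWt.
exact: le_trans le0t (L1PCA_step_mono Wt1 PhiWt).
Qed.

(** * Unfolding as a bijection between index sets *)

Lemma ltn_fiber_index (N : nat) (E : 'I_N -> nat) (n k : 'I_N) (c : nat) :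
  (c < \prod_(m < N | m != n) E m)%N -> k != n -> (fiber_index E n c k < E k)%N.
Proof.
move=> c_lt nk; apply: ltn_pmod; have := leq_ltn_trans (leq0n c) c_lt.
by rewrite (bigD1 k) //= muln_gt0 => /andP[].
Qed.

(* Mixed-radix expansions with equal digits agree modulo each partial product
   of the radices, hence agree. *)
Lemma fiber_index_inj (N : nat) (E : 'I_N -> nat) (n : 'I_N) (c c' : nat) :
  (c < \prod_(m < N | m != n) E m)%N -> (c' < \prod_(m < N | m != n) E m)%N ->
  (forall k, k != n -> fiber_index E n c k = fiber_index E n c' k) -> c = c'.
Proof.
move=> c_lt c'_lt digits.
(* [P k] is the place value of the digit of mode [k]: the product of the earlier radices, mode [n]
   skipped. *)
pose P (k : nat) := (\prod_(m < N | (m < k) && (m != n)) E m)%N.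
have modP k : (k <= N)%N -> c = c' %[mod P k].
  elim: k => [_|k IHk lt_kN]; first by rewrite /P big_pred0 // !modn1.
  pose o := Ordinal lt_kN; have [on|on] := eqVneq o n.
    (* Mode [n] contributes no digit, so the modulus does not grow there. *)
    have -> : P k.+1 = P k; last exact: IHk (ltnW lt_kN).
    apply: eq_bigl => m; rewrite ltnS leq_eqVlt.
    by rewrite -on -(inj_eq val_inj m o) /=; case: ltngtP.
  have PS : P k.+1 = (E o * P k)%N.
    rewrite /P (bigD1 o) /=; last by rewrite ltnSn.
    congr (_ * _)%N; apply: eq_bigl => m.
    rewrite ltnS -(inj_eq val_inj m o) /= ltn_neqAle.
    by rewrite [LHS]andbC andbA.
  (* The residue modulo the next place value is the digit at [k] on top of the previous residue. *)
  have modS x : (x %% P k.+1 = ((x %/ P k) %% E o) * P k + x %% P k)%N.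
    rewrite [LHS](divn_eq _ (P k)) PS modn_divl; congr (_ + _)%N.
    by rewrite modn_dvdm // dvdn_mull.
  by rewrite !modS IHk ?(ltnW lt_kN) //; congr (_ * _ + _)%N; exact: digits on.
have PN : P N = (\prod_(m < N | m != n) E m)%N.
  by apply: eq_bigl => m; rewrite ltn_ord.
by have := modP N (leqnn N); rewrite PN !modn_small.
Qed.

(** The map from (row, column) to multi-index is injective by uniqueness of digits, and bijective
    because both sides have the same cardinality; the two sums are reindexed along it. *)
Lemma mx_norm1_unfolding (R : realType) (N : nat) (E : 'I_N -> nat)
    (n : 'I_N) (Y : array R N) :
  mx_norm1 (unfolding n (E n) E Y) = tensor_norm1 (tensor_of (E := E) Y).
Proof.
pose pos (rc : 'I_(E n) * 'I_(\prod_(m < N | m != n) E m)) (k : 'I_N) : nat :=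
  if k == n then rc.1 : nat else fiber_index E n rc.2 k.
have pos_lt rc k : (pos rc k < E k)%N.
  by rewrite /pos; case: eqVneq => [->|nk] //; exact: ltn_fiber_index.
pose h rc : {dffun forall k, 'I_(E k)} := [ffun k => Ordinal (pos_lt rc k)].
have hE rc k : h rc k = pos rc k :> nat by rewrite ffunE.
have h_inj : injective h.
  move=> [r c] [r' c'] eq_h.
  have eq_pos k : pos (r, c) k = pos (r', c') k by rewrite -!hE eq_h.
  congr (_, _); apply: val_inj; first by have := eq_pos n; rewrite /pos eqxx.
  apply: (@fiber_index_inj _ E n); rewrite ?ltn_ord // => k nk.
  by have := eq_pos k; rewrite /pos (negPf nk).
have h_bij : bijective h.
  apply: inj_card_bij h_inj _; rewrite card_prod !card_ord card_dep_ffun.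
  rewrite foldrE big_map big_enum /= (eq_bigr E) => [|k _]; last exact: card_ord.
  by rewrite (bigD1 n).
rewrite /mx_norm1 pair_big /tensor_norm1 (reindex h) /=; last exact: onW_bij.
apply: eq_bigr => -[r c] _; rewrite mxE /tensor_of; congr (`|Y _|).
by apply/ffunP => k; rewrite !ffunE.
Qed.

(** * Reordering mode products *)

Lemma mode_prodC (R : comNzRingType) (N : nat) (m n : 'I_N) (p q p' q' : nat)
    (A : 'M[R]_(p, q)) (B : 'M[R]_(p', q')) (Y : array R N) :
  m != n -> mode_prod m A (mode_prod n B Y) = mode_prod n B (mode_prod m A Y).
Proof.
move=> mn; apply: funext => i; rewrite /mode_prod.
have set_neq k l c : k != l -> set_index i k c l = i l.
  by move=> kl; rewrite ffunE eq_sym (negPf kl).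
have setC c c' : set_index (set_index i m c) n c' = set_index (set_index i n c') m c.
  apply/ffunP => k; rewrite !ffunE; case: (eqVneq k n) => // ->.
  by rewrite eq_sym (negPf mn).
(* An index outside the row range of either matrix makes both sides zero. *)
case Em: (insub (i m)) => [r|]; case En: (insub (i n)) => [s|] //.
- under eq_bigr => c _ do rewrite set_neq // En mulr_sumr.
  under [RHS]eq_bigr => c _ do rewrite set_neq 1?eq_sym // Em mulr_sumr.
  rewrite exchange_big /=; apply: eq_bigr => c _; apply: eq_bigr => c' _.
  by rewrite setC mulrCA.
- by rewrite big1 // => c _; rewrite set_neq // En mulr0.
- by rewrite big1 // => c _; rewrite set_neq 1?eq_sym // Em mulr0.
Qed.

Lemma mode_prods_mode_prod (R : comNzRingType) (N : nat) (p q : 'I_N -> nat)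
    (s : seq 'I_N) (M : forall n, 'M[R]_(p n, q n)) (n : 'I_N) (p' q' : nat)
    (A : 'M[R]_(p', q')) (Y : array R N) :
  n \notin s ->
  mode_prods s M (mode_prod n A Y) = mode_prod n A (mode_prods s M Y).
Proof.
elim: s Y => //= m s IHs Y; rewrite inE negb_or => /andP[nm ns].
by rewrite /mode_prods /= mode_prodC 1?eq_sym // -/(mode_prods _ _ _) IHs.
Qed.

Lemma eq_in_mode_prods (R : nzRingType) (N : nat) (p q : 'I_N -> nat)
    (s : seq 'I_N) (M M' : forall n, 'M[R]_(p n, q n)) (Y : array R N) :
  {in s, forall n, M n = M' n} -> mode_prods s M Y = mode_prods s M' Y.
Proof.
elim: s Y => //= m s IHs Y eqM; rewrite /mode_prods /= eqM ?mem_head //.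
by apply: IHs => n ns; rewrite eqM // inE ns orbT.
Qed.

(** Both lists are strictly increasing with the same members. *)
Lemma enum_ord_split (N : nat) (n : 'I_N) :
  enum 'I_N = [seq m : 'I_N <- enum 'I_N | (m < n)%N]
    ++ n :: [seq k : 'I_N <- enum 'I_N | (n < k)%N].
Proof.
pose lt := [rel i j : 'I_N | (i < j)%N].
have lt_tr : transitive lt by move=> i j k; exact: ltn_trans.
have enum_sorted : sorted lt (enum 'I_N).
  by rewrite -(sorted_map (f := val) (e' := ltn)) val_enum_ord iota_ltn_sorted.
have filter_sorted a : pairwise lt [seq i <- enum 'I_N | a i].
  by rewrite -(sorted_pairwise lt_tr); exact: sorted_filter.
apply: (irr_sorted_eq lt_tr) => //; first by move=> i; exact: ltnn.
  rewrite (sorted_pairwise lt_tr) pairwise_cat pairwise_cons.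
  rewrite !filter_sorted andbT /=; apply/andP; split; last first.
    by apply/allP => k; rewrite mem_filter => /andP[].
  apply/allrelP => m k; rewrite mem_filter => /andP[mn _].
  rewrite inE mem_filter => /predU1P[->//|/andP[nk _]].
  exact: ltn_trans nk.
move=> k; rewrite mem_cat in_cons (mem_filter (fun m : 'I_N => m < n)%N).
rewrite (mem_filter (fun m : 'I_N => n < m)%N) !mem_enum !andbT.
by rewrite -(inj_eq val_inj) /=; case: ltngtP.
Qed.

(** Commutation lets the mode-[n] product be applied last, where unfolding turns it into a left
    multiplication. The metric thus becomes the objective of L1PCA-AO in mode [n]. *)
Lemma L1_Tucker_metric_HOOI (R : realType) (N : nat) (D d : 'I_N -> nat)
    (X : tensor R D) (V : forall n : 'I_N, 'M[R]_(D n, d n)) (n : 'I_N) :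
  L1_Tucker_metric X V = mx_norm1 ((HOOI_matrix X V V n)^T *m V n).
Proof.
rewrite -mx_norm1_tr trmx_mul trmxK /HOOI_matrix -unfolding_mode_prod.
rewrite mx_norm1_unfolding /L1_Tucker_metric {1}(enum_ord_split n).
rewrite /mode_prods foldl_cat /= -/(mode_prods _ _ _) -/(mode_prods _ _ _).
by rewrite mode_prods_mode_prod // mem_filter ltnn.
Qed.

Lemma eq_HOOI_matrix (R : realType) (N : nat) (D d : 'I_N -> nat)
    (X : tensor R D) (U V U' V' : forall n : 'I_N, 'M[R]_(D n, d n))
    (n : 'I_N) :
  (forall m : 'I_N, (m < n)%N -> U m = U' m) ->
  (forall k : 'I_N, (n < k)%N -> V k = V' k) ->
  HOOI_matrix X U V n = HOOI_matrix X U' V' n.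
Proof.
move=> eqU eqV; rewrite /HOOI_matrix; congr unfolding.
rewrite (@eq_in_mode_prods _ _ _ _ _ (fun k => (V k)^T) (fun k => (V' k)^T)).
  congr mode_prods; apply: eq_in_mode_prods => m.
  by rewrite mem_filter => /andP[/eqU ->].
by move=> k; rewrite mem_filter => /andP[/eqV ->].
Qed.

(** * A bound on the metric uniform over the bases *)

Lemma mode_prod_bounded (R : realType) (N : nat) (n : 'I_N) (p q : nat)
    (A : 'M[R]_(p, q)) (Y : array R N) (B : R) :
  0 <= B -> (forall i j, `|A i j| <= 1) -> (forall i, `|Y i| <= B) ->
  forall i, `|mode_prod n A Y i| <= q%:R * B.
Proof.
move=> B0 A1 YB i; rewrite /mode_prod; case: insubP => [r _ _|_]; last first.
  by rewrite normr0 mulr_ge0.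
apply: le_trans (ler_norm_sum _ _ _) _.
rewrite -[q in leRHS]card_ord -sumr_const mulr_suml.
by apply: ler_sum => c _; rewrite normrM ler_pM ?A1.
Qed.

(** [C] is chosen before [M]: a factor with entries in [-1, 1] multiplies the bound by at most its
    number of columns. *)
Lemma mode_prods_bounded (R : realType) (N : nat) (p q : 'I_N -> nat)
    (s : seq 'I_N) (Y : array R N) (B : R) :
  0 <= B -> (forall i, `|Y i| <= B) ->
  exists C : R, forall M : forall n, 'M[R]_(p n, q n),
    (forall n i j, `|M n i j| <= 1) -> forall i, `|mode_prods s M Y i| <= C.
Proof.
move=> B0 YB.
exists (foldl (fun C n => (q n)%:R * C) B s) => M M1.
elim: s Y B B0 YB => //= n s IHs Y B B0 YB.
by apply: IHs; [exact: mulr_ge0 | exact: mode_prod_bounded].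
Qed.

Lemma array_of_bounded (R : realType) (N : nat) (D : 'I_N -> nat)
    (X : tensor R D) i : `|array_of X i| <= tensor_norm1 X.
Proof.
rewrite /array_of; case: pickP => [j _|_].
  by rewrite /tensor_norm1 (bigD1 j) //= lerDl sumr_ge0.
by rewrite normr0 sumr_ge0.
Qed.

Lemma L1_Tucker_metric_bounded (R : realType) (N : nat) (D d : 'I_N -> nat)
    (X : tensor R D) :
  exists C : R, forall V : forall n : 'I_N, 'M[R]_(D n, d n),
    (forall n, stiefel (V n)) -> L1_Tucker_metric X V <= C.
Proof.
have X0 : 0 <= tensor_norm1 X by exact: sumr_ge0.
have [C CP] := @mode_prods_bounded R N d D (enum 'I_N) _ _ X0 (array_of_bounded X).
exists (\sum_(j : {dffun forall n : 'I_N, 'I_(d n)}) C) => V V1.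
apply: ler_sum => j _; apply: CP => n r c.
by rewrite mxE stiefel_entry_le1.
Qed.

(** * Monotonicity over a sweep and convergence *)

Lemma L1_HOOI_stiefel (R : realType) (N : nat) (D d : 'I_N -> nat)
    (X : tensor R D) (U : nat -> forall n : 'I_N, 'M[R]_(D n, d n)) :
  L1_HOOI X U -> forall q n, stiefel (U q n).
Proof.
move=> [U0 Ustep] [|q] n; first exact: U0.
exact: L1PCA_AO_stiefel (Ustep q n).
Qed.

(* A sweep passes from the bases U q to U q.+1 through families updated in the
   first k modes only. *)
Lemma L1_HOOI_mono (R : realType) (N : nat) (D d : 'I_N -> nat)
    (X : tensor R D) (U : nat -> forall n : 'I_N, 'M[R]_(D n, d n)) (q : nat) :
  L1_HOOI X U -> L1_Tucker_metric X (U q) <= L1_Tucker_metric X (U q.+1).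
Proof.
move=> HU; have U1 := L1_HOOI_stiefel HU.
pose mix (k : nat) (m : 'I_N) := if (m < k)%N then U q.+1 m else U q m.
have mixN : mix N = U q.+1.
  by apply: functional_extensionality_dep => m; rewrite /mix ltn_ord.
suff: forall k, (k <= N)%N -> L1_Tucker_metric X (U q) <= L1_Tucker_metric X (mix k).
  by move=> /(_ N (leqnn N)); rewrite mixN.
elim=> [_|k IHk lt_kN].
  by have -> : mix 0%N = U q by apply: functional_extensionality_dep.
apply: le_trans (IHk (ltnW lt_kN)) _; pose n := Ordinal lt_kN.
rewrite !(L1_Tucker_metric_HOOI X _ n).
(* Before and after the update of mode [n], the other modes hold exactly the bases that the
   algorithm uses to build its matrix. *)
have mixE j : (j == k) || (j == k.+1) ->
    HOOI_matrix X (mix j) (mix j) n = HOOI_matrix X (U q.+1) (U q) n.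
  move=> jk; apply: eq_HOOI_matrix => m; rewrite /mix /= => lt_m.
    by case/orP: jk => /eqP ->; rewrite ?lt_m // ltnS (ltnW lt_m).
  by case/orP: jk => /eqP ->; rewrite ltnNge ?lt_m // (ltnW lt_m).
rewrite !mixE ?eqxx ?orbT // /mix /= ltnn ltnSn.
by apply: L1PCA_AO_mono => //; exact: HU.2.
Qed.

Theorem mainTheorem2 (R : realType) (N : nat) (D d : 'I_N -> nat)
    (d_le_D : forall n : 'I_N, (d n <= D n)%N)
    (X : tensor R D)
    (U : nat -> forall n : 'I_N, 'M[R]_(D n, d n))
    (U_HOOI : L1_HOOI X U) :
  cvgn (fun q : nat => L1_Tucker_metric X (U q.+1)).
Proof.
apply: nondecreasing_is_cvgn.
  by apply/nondecreasing_seqP => q; exact: L1_HOOI_mono.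
have [C CP] := L1_Tucker_metric_bounded d X.
by exists C => _ [q _ <-]; apply/CP/L1_HOOI_stiefel/U_HOOI.
Qed.
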